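(* Let $G$ and $H$ be finite simple graphs with $Q(G;x,y)=Q(H;x,y)$. Then $c(G)=c(H)$; that is, the connectivity of a graph is determined by its subgraph component polynomial.
   Context: For a finite simple graph $G=(V,E)$ and $X\subseteq V$, $G[X]$ is the induced subgraph on $X$ and $k(G[X])$ its number of connected components (with $k$ of the empty graph equal to $0$). The subgraph component polynomial is $Q(G;x,y)=\sum_{X\subseteq V} x^{|X|}y^{k(G[X])}$. The connectivity $c(G)$ of a non-complete graph is the minimum cardinality of a vertex set whose removal leaves a disconnected graph; by convention $c(K_n)=n-1$. *)

(* Defs.v *)
From mathcomp Require Import all_boot all_order all_algebra.
Set Implicit Arguments.
Unset Strict Implicit.
Unset Printing Implicit Defensive.
Import GRing.Theory.
Local Open Scope ring_scope.

Record sgraph := SGraph {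
  vertex :> finType;
  edge : rel vertex;
  edge_sym : symmetric edge;
  edge_irrefl : irreflexive edge
}.

Definition induced_edge (G : sgraph) (X : {set G}) : rel G :=
  [rel u v | [&& u \in X, v \in X & edge u v]].

(* [n_comp] only counts components for a symmetric relation and a set closed
   under it; [induced_edge X] and [X] meet both conditions. *)
Definition ncomponents (G : sgraph) (X : {set G}) : nat :=
  n_comp (induced_edge X) X.

(* In Z[y][x], following the library's bivariate convention: 'X is x and
   'Y, that is 'X%:P, is y. *)
Definition subgraph_component_poly (G : sgraph) : {poly {poly int}} :=
  \sum_(X : {set G}) 'X^#|X| * 'Y^+(ncomponents X).

Definition complete (G : sgraph) : bool :=
  [forall u : G, forall v : G, (u != v) ==> edge u v].

(* S is a vertex cut: G - S has at least two components (so the empty graph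
   does not count as disconnected). *)
Definition disconnecting (G : sgraph) (S : {set G}) : bool :=
  (1 < ncomponents (~: S))%N.

(* The start value #|G| of the minimum bounds every #|S|, and a non-complete
   graph has a disconnecting set (all vertices but two non-adjacent ones), so
   it never affects the result. For the graph without vertices, truncated
   subtraction gives 0. *)
Definition connectivity (G : sgraph) : nat :=
  if complete G then #|G|.-1
  else \big[minn/#|G|]_(S : {set G} | disconnecting S) #|S|.

(* Main.v *)
(** The coefficient of x^i y^j in Q counts the vertex sets of size i inducing
    j components, so Q determines which pairs (size, number of components)
    occur.  Everything is read off from these pairs: the order of G is the
    largest size, G is complete iff no vertex set induces more than one
    component, and a vertex cut of size k is the complement of a set of size
    |G| - k inducing more than one component. *)
Require Import Defs.
From mathcomp Require Import all_boot all_order all_algebra.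
Import Order.TTheory GRing.Theory Num.Theory.

Lemma coef_subgraph_component_poly (G : sgraph) (i j : nat) :
  (((subgraph_component_poly G)`_i)`_j)%R =
  #|[set X : {set G} | (#|X| == i) && (ncomponents X == j)]|%:R%R.
Proof.
rewrite /subgraph_component_poly !coef_sum cardsE -sum1_card natr_sum.
rewrite [RHS]big_mkcond /=; apply: eq_bigr => X _.
(* The power of y is a constant polynomial in x, so each term contributes a product of two 0/1
   indicators. *)
rewrite -polyC_exp coefMC coefXn mulr_natl coefMn coefXn unfold_in /=.
by rewrite ![_ == i]eq_sym ![_ == j]eq_sym; case: (i == _); case: (j == _).
Qed.

(** [X] itself makes one coefficient of Q positive, so that coefficient also counts some set of
    [H]. *)
Lemma eq_component_poly_transfer (G H : sgraph) (X : {set G}) :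
  subgraph_component_poly G = subgraph_component_poly H ->
  exists2 Y : {set H}, #|Y| = #|X| & ncomponents Y = ncomponents X.
Proof.
move=> eqQ; have := coef_subgraph_component_poly G #|X| (ncomponents X).
rewrite eqQ coef_subgraph_component_poly => /eqP; rewrite eqr_nat.
move=> /eqP eq_card.
have : 0 < #|[set Z : {set G} | (#|Z| == #|X|)
                                && (ncomponents Z == ncomponents X)]|.
  by apply/card_gt0P; exists X; rewrite inE !eqxx.
rewrite -eq_card => /card_gt0P[Y]; rewrite inE => /andP[/eqP ? /eqP ?].
by exists Y.
Qed.

Lemma induced_connect_sym (G : sgraph) (X : {set G}) :
  connect_sym (induced_edge X).
Proof.
by apply: sym_connect_sym => u v; rewrite /induced_edge /= edge_sym andbCA.
Qed.

(** Restates completeness through component counts, which transfer between graphs. *)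
Lemma completePn (G : sgraph) :
  reflect (exists X : {set G}, 1 < ncomponents X) (~~ complete G).
Proof.
apply: (iffP idP) => [|[X /card_gt1P[u [v [uX vX neq_uv]]]]].
  case/forallPn=> u /forallPn[v]; rewrite negb_imply => /andP[neq_uv nuv].
  exists [set u; v].
  have no_edge a b : induced_edge [set u; v] a b = false.
    apply/negP=> /and3P[]; rewrite !inE.
    case/pred2P=> ->; case/pred2P=> ->; rewrite ?edge_irrefl ?(negPf nuv) //.
    by rewrite edge_sym (negPf nuv).
  (* Without edges only the empty path is left, so [u] and [v] are roots of two different
     components. *)
  have isroot w : roots (induced_edge [set u; v]) w.
    have /connectP[[|b p] /= ] := connect_root (induced_edge [set u; v]) w.
      by move=> _ eq_w; rewrite /roots /= eq_w.
    by rewrite no_edge.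
  by apply/card_gt1P; exists u, v; rewrite !inE !isroot !eqxx orbT.
(* [ncomponents] counts roots, so [u] and [v] are distinct roots in [X]; an edge joining them would
   make their roots equal. *)
move: uX vX; rewrite !inE => /andP[/eqP ru uX] /andP[/eqP rv vX].
apply/negP=> /forallP/(_ u)/forallP/(_ v)/implyP/(_ neq_uv) adj.
case/eqP: neq_uv; rewrite -ru -rv; apply/eqP.
rewrite (root_connect (induced_connect_sym _ X)); apply: connect1.
by rewrite /induced_edge /= uX vX adj.
Qed.

Lemma connectivity_le (G H : sgraph) :
  subgraph_component_poly G = subgraph_component_poly H -> #|G| = #|H| ->
  ~~ complete G -> ~~ complete H -> connectivity G <= connectivity H.
Proof.
move=> eqQ eqn /negPf ncG /negPf ncH; rewrite /connectivity ncG ncH.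
rewrite -leEnat -minEnat; apply/bigmin_geP; split=> [|S cutS].
  (* The start value [#|H|] must be bounded as well; it equals the start value on the other side. *)
  by rewrite -eqn; exact: bigmin_le_id.
(* What transfers is the complement of the cut; as the orders agree, [~: Y] is a cut of [G] of size
   [#|S|]. *)
have [Y sizeY compY] := eq_component_poly_transfer _ _ (~: S) (esym eqQ).
have -> : #|S| = #|~: Y|.
  by rewrite (cardsCs S) (cardsCs (~: Y)) setCK sizeY eqn.
apply: bigmin_le_cond.
by rewrite /disconnecting setCK compY.
Qed.

Theorem theorem3p2 (G H : sgraph) :
  subgraph_component_poly G = subgraph_component_poly H ->
  connectivity G = connectivity H.
Proof.
have order_le (G1 G2 : sgraph) :
    subgraph_component_poly G1 = subgraph_component_poly G2 -> #|G1| <= #|G2|.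
  (* The whole vertex set has a counterpart of the same size in [G2]. *)
  move/(eq_component_poly_transfer _ _ [set: G1]) => [Y sizeY _].
  by rewrite -cardsT -sizeY max_card.
have noncomplete (G1 G2 : sgraph) :
    subgraph_component_poly G1 = subgraph_component_poly G2 ->
    ~~ complete G1 -> ~~ complete G2.
  move=> eqQ /completePn[X]; have [Y _ <-] := eq_component_poly_transfer _ _ X eqQ.
  by move=> compY; apply/completePn; exists Y.
move=> eqQ.
have eqn : #|G| = #|H| by apply/eqP; rewrite eqn_leq !order_le.
have [cG|ncG] := boolP (complete G).
  have cH : complete H by apply: contraLR cG; apply: noncomplete.
  by rewrite /connectivity cG cH eqn.
have ncH := noncomplete _ _ eqQ ncG.
by apply/eqP; rewrite eqn_leq !connectivity_le.
Qed.
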